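(* Consider a network of $n$ links with a conflict graph that is $C$-independent for a constant $C=O(1)$, in which each link runs a learning algorithm choosing between ''send'' and ''not send'' in every time step (phase length $k=1$) with the utility $u$ below. Every sequence of action vectors with average regret $\epsilon\le\frac{1}{4n}\cdot\frac{\delta^2}{2-\delta}$ for all links yields an $O(1/\delta^2)$-approximation of the average optimum against individual $(T',1-\delta)$-bounded adversaries and an $O(1/\delta)$-approximation against $(T',1-\delta)$-exact adversaries.
   Context: Links in a set $V$ ($|V|=n$) share one channel in synchronized time steps. Conflict graph: weights $b_u(v)\ge0$; if a set $L$ transmits, $v\in L$ succeeds iff the step is not jammed for $v$ and $\sum_{u\in L}b_u(v)\le1$; feasible sets: all links can succeed simultaneously; $C$-independence: every feasible $L$ contains $L'$ with $|L'|=\Omega(|L|)$ and $\sum_{v\in L'}b_u(v)\le C$ for all $u$. A $(T',1-\delta)$-bounded adversary jams at most a $(1-\delta)$-fraction of the steps in any window of at least $T'$ consecutive steps; an exact one jams exactly a $(1-\delta)$-fraction of any window of $T'$ steps; an individual adversary decides per link, subject to the same constraint per link. Jammed transmissions fail; links observe only their own success/failure; $T'$ is not known to the links, $\delta$ is. Utility in step $t$: $u_i^{(t)}=1$ if $\ell_i$ transmits successfully, $-\frac{\delta}{2-\delta}$ if $\ell_i$ transmits unsuccessfully, $0$ if it does not transmit. Average regret: (max over the two constant actions of the total utility they would have obtained, minus total utility obtained) divided by the number of time steps. Optimum in a step: maximum-cardinality set of non-jammed links that can succeed simultaneously; approximation factor $\rho$: average optimum over time steps is at most $\rho$ times average number of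 successful transmissions per step.
   Formalization: Added: no link has weight on itself (b_v(v)=0); the number T of time steps satisfies T ≥ T' for bounded adversaries, and for exact adversaries T is a multiple of T' or at least an absolute constant times T'. Without these the claim fails. *)

(* Defs.v *)
From mathcomp Require Import all_boot all_order all_algebra.
Set Implicit Arguments.
Unset Strict Implicit.
Unset Printing Implicit Defensive.
Import Order.TTheory GRing.Theory Num.Theory.
Local Open Scope ring_scope.

(* [weight u v] is b_u(v), the interference that u causes at v.  A conflict
   graph has no loops: a link does not interfere with itself. *)
Record conflict_graph (R : realFieldType) (V : finType) := ConflictGraph {
  weight :> V -> V -> R;
  weight_ge0 : forall u v, 0 <= weight u v;
  weight_loopless : forall v, weight v v = 0
}.

Section Network.
Variables (R : realFieldType) (V : finType) (G : conflict_graph R V).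

Definition interference (L : {set V}) (v : V) : R := \sum_(u in L) G u v.

(* [Jt] is the set of links jammed in the step, [L] the set of transmitters;
   jammed transmitters still cause interference. *)
Definition succeeds (Jt L : {set V}) (v : V) : bool :=
  [&& v \in L, v \notin Jt & interference L v <= 1].

Definition feasible (L : {set V}) : bool := [forall v in L, succeeds set0 L v].

(* [kappa] is the constant hidden in |L'| = Omega(|L|). *)
Definition C_independent (kappa C : R) : Prop :=
  forall L : {set V}, feasible L ->
  exists L' : {set V}, [/\ L' \subset L,
    kappa * #|L|%:R <= #|L'|%:R
    & forall u, \sum_(v in L') G u v <= C].

Definition opt (Jt : {set V}) : nat :=
  \max_(L : {set V} | feasible L && [disjoint L & Jt]) #|L|.

Definition utility (delta : R) (Jt L : {set V}) (v : V) : R :=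
  if v \in L then
    if succeeds Jt L v then 1 else - (delta / (2 - delta))
  else 0.

Definition switch (send : bool) (v : V) (L : {set V}) : {set V} :=
  if send then v |: L else L :\ v.

(* In what follows, [J t] is the set of links jammed in step [t], [act t] the
   set of links that transmit in step [t], and the steps are 0, ..., T - 1. *)
Definition total_utility (delta : R) (J act : nat -> {set V}) (T : nat)
    (v : V) : R :=
  \sum_(0 <= t < T) utility delta (J t) (act t) v.

(* Total utility of [v] under a constant action, the others' actions and the
   jamming being unchanged. *)
Definition constant_utility (delta : R) (J act : nat -> {set V}) (T : nat)
    (v : V) (send : bool) : R :=
  total_utility delta J (fun t => switch send v (act t)) T v.

Definition average_regret (delta : R) (J act : nat -> {set V}) (T : nat)
    (v : V) : R :=
  (Num.max (constant_utility delta J act T v true)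
           (constant_utility delta J act T v false)
   - total_utility delta J act T v) / T%:R.

Definition average_optimum (J : nat -> {set V}) (T : nat) : R :=
  (\sum_(0 <= t < T) opt (J t))%:R / T%:R.

Definition average_successes (J act : nat -> {set V}) (T : nat) : R :=
  (\sum_(0 <= t < T) #|[set v | succeeds (J t) (act t) v]|)%:R / T%:R.

Definition approximates (rho : R) (J act : nat -> {set V}) (T : nat) : Prop :=
  average_optimum J T <= rho * average_successes J act T.

End Network.

Definition jam_count (jam : nat -> bool) (t w : nat) : nat :=
  \sum_(t <= s < t + w) jam s.

Definition bounded_adversary (R : realFieldType) (T' : nat) (p : R)
    (jam : nat -> bool) : Prop :=
  forall t w : nat, (T' <= w)%N -> (jam_count jam t w)%:R <= p * w%:R.

Definition exact_adversary (R : realFieldType) (T' : nat) (p : R)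
    (jam : nat -> bool) : Prop :=
  forall t : nat, (jam_count jam t T')%:R = p * T'%:R.

(* An individual adversary satisfies its constraint separately on each link. *)
Definition individual (V : finType) (P : (nat -> bool) -> Prop)
    (J : nat -> {set V}) : Prop :=
  forall v, P (fun t => v \in J t).

(* A non-individual adversary jams the shared channel, hence all links at
   once. *)
Definition jam_all (V : finType) (jam : nat -> bool) (t : nat) : {set V} :=
  if jam t then setT else set0.
Arguments jam_all V jam t : clear implicits.

(* Main.v *)
Require Import Defs.
From mathcomp Require Import all_boot all_order all_algebra.
From mathcomp Require Import ring lra.
Set Implicit Arguments.
Unset Strict Implicit.
Unset Printing Implicit Defensive.
Import Order.TTheory GRing.Theory Num.Theory.
Local Open Scope ring_scope.

(* For a link v let q be its number of transmissions, s its number of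
   successes and i the number of steps in which the others' interference at v
   exceeds 1.  Low regret against "not send" gives delta q <= 2 s + small, and
   low regret against "send", together with the jamming bound, gives
   s + i >= c delta T.  In every step counted by s or i some link transmits, so
   one such v already forces sum q >= c delta T; hence the regret terms are
   absorbed and delta sum q = O(sum s).  Fix a maximum feasible set and its
   C-independent part L'.  Summing s + i >= c delta T over L' and bounding the
   interference that each transmitter causes in L' by C gives
   |L'| delta T = O(sum q) = O(sum s / delta).  The optimum is at most
   |L'| / kappa per step; against an exact adversary it vanishes in all but
   O(delta T) steps, which saves a factor delta. *)

(** * A single time step: utility, interference and optimum *)

Section OneStep.
Variables (R : realFieldType) (V : finType) (G : conflict_graph R V).
Implicit Types (Jt L : {set V}) (v : V) (delta : R).

Lemma interference_ge0 L v : 0 <= interference G L v.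
Proof. by apply: sumr_ge0 => u _; apply: weight_ge0. Qed.

Lemma interference_setU1 L v : interference G (v |: L) v = interference G L v.
Proof.
have [vL|vL] := boolP (v \in L); first by rewrite (setUidPr _) // sub1set.
by rewrite /interference big_setU1 //= weight_loopless add0r.
Qed.

(** Scaling by [2 - delta] makes a success worth [2 - delta] and a failure [- delta], so utility
    becomes linear in the two indicators and can be summed over steps. *)
Lemma utilityE delta Jt L v : delta <= 1 ->
  (2 - delta) * utility G delta Jt L v =
  2 * (succeeds G Jt L v)%:R - delta * (v \in L)%:R.
Proof.
move=> d1; have d2 : 2 - delta != 0 by rewrite gt_eqF; lra.
rewrite /utility /succeeds; case: (v \in L) => /=; last by rewrite !mulr0 subr0.
by case: ifP => _ /=; [ring | field].
Qed.

(** A failed transmission scores 2 less than a success after scaling. A step both jammed and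
    disturbed is charged twice, hence only an inequality. *)
Lemma utility_send_ge delta Jt L v : delta <= 1 ->
  (2 - delta) - 2 * ((v \in Jt)%:R + (1 < interference G L v)%R%:R) <=
  (2 - delta) * utility G delta Jt (switch true v L) v.
Proof.
move=> d1; rewrite utilityE // /succeeds /= setU11 interference_setU1.
by case: (v \in Jt); case: ltP => _ /=; lra.
Qed.

Lemma utility_silent delta Jt L v :
  utility G delta Jt (switch false v L) v = 0.
Proof. by rewrite /utility setD11. Qed.

(** The two events exclude each other, and each needs a transmitter: [v] itself or a source of
    interference. *)
Lemma succeeds_disturbed_le_transmitters Jt L v :
  (succeeds G Jt L v)%:R + (1 < interference G L v)%R%:R <= #|L|%:R :> R.
Proof.
rewrite -natrD ler_nat /succeeds.
case: ltP => [lt1|_] /=; last first.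
  rewrite addn0 andbT; case: (boolP (v \in L)) => //= vL.
  by rewrite (leq_trans (leq_b1 _)) // card_gt0; apply/set0Pn; exists v.
rewrite !andbF card_gt0; apply: contraTneq lt1 => ->.
by rewrite /interference big_set0 ltr10.
Qed.

Lemma opt_witness Jt :
  exists2 L : {set V}, feasible G L && [disjoint L & Jt] & opt G Jt = #|L|.
Proof.
have f0 : feasible G set0 && [disjoint (set0 : {set V}) & Jt].
  rewrite /feasible disjoints_subset sub0set andbT.
  by apply/forall_inP => v; rewrite inE.
by rewrite /opt (bigop.bigmax_eq_arg set0) //; case: arg_maxnP => //= L PL _; exists L.
Qed.

Lemma opt_le_opt0 Jt : (opt G Jt <= opt G set0)%N.
Proof.
have [L /andP[fL _] ->] := opt_witness Jt.
by rewrite /opt leq_bigmax_cond // fL disjoints_subset setC0 subsetT.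
Qed.

Lemma opt_setT : opt G setT = 0%N.
Proof.
have [L /andP[_]] := opt_witness setT.
by rewrite disjoints_subset setCT subset0 => /eqP -> ->; rewrite cards0.
Qed.

End OneStep.

(** * Totals over the horizon and the consequences of low regret *)

Section ManySteps.
Variables (R : realFieldType) (V : finType) (G : conflict_graph R V).
Variables (J act : nat -> {set V}) (T : nat).
Implicit Types (delta eps C : R) (v : V).

Definition sends v : R := \sum_(0 <= t < T) (v \in act t)%:R.
Definition successes v : R :=
  \sum_(0 <= t < T) (succeeds G (J t) (act t) v)%:R.
Definition jams v : R := \sum_(0 <= t < T) (v \in J t)%:R.
(* Jammed steps are counted as well when the interference exceeds 1. *)
Definition disturbances v : R :=
  \sum_(0 <= t < T) (1 < interference G (act t) v)%R%:R.

Lemma total_successesE :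
  (\sum_(0 <= t < T) #|[set v | succeeds G (J t) (act t) v]|)%:R =
  \sum_v successes v.
Proof.
rewrite natr_sum exchange_big /=; apply: eq_bigr => t _.
by rewrite -sum1_card natr_sum big_mkcond; apply: eq_bigr => v _; rewrite inE; case: ifP.
Qed.

Lemma total_sendsE : \sum_v sends v = \sum_(0 <= t < T) #|act t|%:R.
Proof.
rewrite exchange_big /=; apply: eq_bigr => t _.
by rewrite -sum1_card natr_sum [RHS]big_mkcond; apply: eq_bigr => v _; case: ifP.
Qed.

Lemma successes_ge0 v : 0 <= successes v.
Proof. by apply: sumr_ge0 => t _; apply: ler0n. Qed.

Lemma total_utilityE delta v : delta <= 1 ->
  (2 - delta) * total_utility G delta J act T v =
  2 * successes v - delta * sends v.
Proof.
move=> d1; rewrite /total_utility !mulr_sumr -sumrB; apply: eq_bigr => t _.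
exact: utilityE.
Qed.

Lemma sum_const_steps (x : R) : \sum_(0 <= t < T) x = x * T%:R.
Proof. by rewrite sumr_const_nat subn0 mulr_natr. Qed.

Lemma constant_utility_send_ge delta v : delta <= 1 ->
  (2 - delta) * T%:R - 2 * (jams v + disturbances v) <=
  (2 - delta) * constant_utility G delta J act T v true.
Proof.
move=> d1; rewrite -sum_const_steps -big_split /= !mulr_sumr -sumrB.
by apply: ler_sum => t _; apply: utility_send_ge.
Qed.

Lemma constant_utility_silent delta v : constant_utility G delta J act T v false = 0.
Proof. by apply: big1 => t _; apply: utility_silent. Qed.

Lemma sends_le delta eps v : delta <= 1 -> (0 < T)%N ->
  average_regret G delta J act T v <= eps ->
  delta * sends v <= 2 * successes v + (2 - delta) * (eps * T%:R).
Proof.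
move=> d1 T0; rewrite /average_regret ler_pdivrMr ?ltr0n // lerBlDr ge_max.
case/andP=> _; rewrite constant_utility_silent => H.
have := total_utilityE v d1.
have : 0 <= (2 - delta) * (eps * T%:R + total_utility G delta J act T v).
  by rewrite mulr_ge0 //; lra.
by lra.
Qed.

Lemma unjammed_le delta eps v : delta <= 1 -> (0 < T)%N ->
  average_regret G delta J act T v <= eps ->
  (2 - delta) * T%:R - 2 * (jams v + disturbances v) <=
  2 * successes v - delta * sends v + (2 - delta) * (eps * T%:R).
Proof.
move=> d1 T0; rewrite /average_regret ler_pdivrMr ?ltr0n // lerBlDr ge_max.
case/andP=> H _; apply: le_trans (constant_utility_send_ge v d1) _.
by rewrite -total_utilityE // -mulrDr ler_wpM2l; lra.
Qed.

Lemma successes_disturbances_le v :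
  successes v + disturbances v <= \sum_u sends u.
Proof.
rewrite total_sendsE -big_split /=; apply: ler_sum => t _.
exact: succeeds_disturbed_le_transmitters.
Qed.

(** A Markov-type bound: the indicator of interference above 1 is at most the interference.
    Exchanging sums charges each transmission with its total weight into [L]. *)
Lemma sum_disturbances_le (C : R) (L : {set V}) :
  (forall u, \sum_(v in L) G u v <= C) ->
  \sum_(v in L) disturbances v <= C * \sum_u sends u.
Proof.
move=> GC; rewrite total_sendsE exchange_big mulr_sumr /=.
apply: ler_sum => t _.
apply: (@le_trans _ _ (\sum_(v in L) interference G (act t) v)).
  apply: ler_sum => v _; case: ltP => [/ltW //|_].
  exact: interference_ge0.
rewrite exchange_big /= mulrC -sum1_card natr_sum mulr_suml.
by apply: ler_sum => u _; rewrite mul1r.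
Qed.

(** Common core of both adversaries; the factor 15/16 leaves room for the partial last window of an
    exact adversary. *)
Lemma feasible_le_successes delta C kappa eps (L : {set V}) :
  0 < delta -> delta <= 1 -> (0 < T)%N ->
  0 < kappa -> C_independent G kappa C -> feasible G L ->
  eps <= 1 / (4 * #|V|%:R) * (delta ^+ 2 / (2 - delta)) ->
  (forall v, average_regret G delta J act T v <= eps) ->
  (forall v, jams v <= (1 - 15 / 16 * delta) * T%:R) ->
  delta ^+ 2 * (#|L|%:R * T%:R) <=
  32 * (1 + `|C|) / kappa * \sum_v successes v.
Proof.
move=> delta_gt0 delta_le1 T_gt0 k0 indep fL eps_le reg jam_le.
set S := \sum_v successes v; set Q := \sum_v sends v.
have S0 : 0 <= S by apply: sumr_ge0 => v _; apply: successes_ge0.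
have C0 : 0 <= `|C| := normr_ge0 C.
have T0 : 0 < T%:R :> R by rewrite ltr0n.
have [V0|V0] := posnP #|V|.
  have -> : #|L| = 0%N by apply/eqP; rewrite -leqn0 -V0 max_card.
  rewrite mul0r mulr0 mulr_ge0 // divr_ge0 ?ltW //; lra.
set e := (2 - delta) * (eps * T%:R).
have n1 : 1 <= #|V|%:R :> R by rewrite ler1n.
have ne : #|V|%:R * e <= delta ^+ 2 / 4 * T%:R.
  rewrite /e [X in X <= _](_ : _ = eps * (#|V|%:R * (2 - delta)) * T%:R); last by ring.
  rewrite ler_pM2r // -ler_pdivlMr; last by rewrite mulr_gt0; lra.
  apply: le_trans eps_le _; rewrite le_eqVlt; apply/orP; left; apply/eqP.
  by field; rewrite !gt_eqF //; lra.
have ddT : delta ^+ 2 * T%:R <= delta * T%:R.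
  by rewrite ler_pM2r // expr2 ler_piMr // ltW.
have e_le : e <= delta / 4 * T%:R.
  (* [eps] may be negative, and only a positive [e] grows when multiplied by [#|V|]. *)
  have [e0|e0] := lerP e 0; first by apply: le_trans e0 _; rewrite mulr_ge0; lra.
  have : e <= #|V|%:R * e by rewrite ler_peMl // ltW.
  lra.
have sends0 v : 0 <= sends v by apply: sumr_ge0 => t _; apply: ler0n.
(* Half of -1 + 15/8 - 1/4: the loss in [2 - delta], the jamming bound and the regret term. *)
have SI v : 5 / 16 * (delta * T%:R) <= successes v + disturbances v.
  have := unjammed_le delta_le1 T_gt0 (reg v); have := jam_le v; rewrite -/e.
  have : 0 <= delta * sends v by rewrite mulr_ge0 // ltW.
  lra.
have [v0 _] : exists v0 : V, true by case/card_gt0P: V0 => v0; exists v0.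
have Q_ge : 5 / 16 * (delta * T%:R) <= Q.
  exact: le_trans (SI v0) (successes_disturbances_le v0).
(* By [Q_ge] and [ne] the regret terms total at most 4/5 of [delta * Q], so a fifth of it is at most
   [2 * S]. *)
have Q_le : delta * Q <= 10 * S.
  have : delta * Q <= 2 * S + #|V|%:R * e.
    rewrite /Q /S !mulr_sumr mulr_natl -sumr_const -big_split /=.
    by apply: ler_sum => v _; apply: sends_le.
  have : delta * (5 / 16 * (delta * T%:R)) <= delta * Q by rewrite ler_pM2l.
  lra.
have [L' [_ kL GC]] := indep L fL.
(* The absolute value keeps the factor nonnegative, since the sign of [C] is not fixed. *)
have L'_le : #|L'|%:R * (5 / 16 * (delta * T%:R)) <= S + `|C| * Q.
  rewrite mulr_natl -sumr_const; apply: (le_trans (ler_sum _ (fun v _ => SI v))).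
  rewrite big_split /=; apply: lerD.
    rewrite /S [X in _ <= X](bigID (mem L')) /= lerDl.
    by apply: sumr_ge0 => v _; apply: successes_ge0.
  apply: le_trans (sum_disturbances_le GC) _.
  by rewrite ler_wpM2r ?ler_norm // sumr_ge0.
have H1 : kappa * #|L|%:R * (delta * T%:R) <= #|L'|%:R * (delta * T%:R).
  by rewrite ler_wpM2r // mulr_ge0 // ltW.
have H2 : delta * (kappa * #|L|%:R * (delta * T%:R)) <= 16 / 5 * (delta * S + `|C| * (delta * Q)).
  rewrite (_ : 16 / 5 * _ = delta * (16 / 5 * (S + `|C| * Q))); last by ring.
  by rewrite ler_pM2l //; lra.
have H3 : `|C| * (delta * Q) <= `|C| * (10 * S) by rewrite ler_wpM2l.
have H4 : delta * S <= S by rewrite ler_piMl.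
rewrite [leRHS]mulrAC ler_pdivlMr //.
rewrite (_ : _ * kappa = delta * (kappa * #|L|%:R * (delta * T%:R))); last by ring.
lra.
Qed.

End ManySteps.

(** * Counting the jammed steps of an exact adversary *)

Lemma jam_countD jam t w1 w2 :
  jam_count jam t (w1 + w2) = (jam_count jam t w1 + jam_count jam (t + w1) w2)%N.
Proof. by rewrite /jam_count addnA (big_cat_nat (leq_addr w1 t) (leq_addr w2 (t + w1)%N)). Qed.

Lemma jam_count_le jam t w : (jam_count jam t w <= w)%N.
Proof.
rewrite -[leqRHS](addKn t) -[leqRHS]muln1 -sum_nat_const_nat.
by apply: leq_sum => s _; apply: leq_b1.
Qed.

Lemma exact_adversary_windows (R : realFieldType) T' (p : R) jam m t :
  exact_adversary T' p jam -> (jam_count jam t (m * T'))%:R = p * (m * T')%:R.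
Proof.
move=> ex; elim: m t => [|m IHm] t.
  by rewrite /jam_count addn0 big_geq // mulr0.
by rewrite mulSn jam_countD !natrD ex IHm mulrDr.
Qed.

(* A partial window at the end is a fraction at most 1/16 of the horizon once
   the horizon has fifteen full windows. *)
Lemma exact_adversary_bounds (R : realFieldType) T' T (delta : R) jam :
  0 < delta -> (0 < T)%N -> (0 < T')%N ->
  (T' %| T)%N \/ (15 * T' <= T)%N ->
  exact_adversary T' (1 - delta) jam ->
  15 / 16 * (delta * T%:R) <= T%:R - (jam_count jam 0 T)%:R <=
  2 * (delta * T%:R).
Proof.
move=> d0 T0 T'0 hT ex.
have [dvd|ndvd] := boolP (T' %| T)%N.
  have := exact_adversary_windows (T %/ T') 0 ex; rewrite divnK // => ->.
  have : 0 <= delta * T%:R by rewrite mulr_ge0 // ltW.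
  by lra.
have {ndvd}hT : (15 * T' <= T)%N by case: hT => // h; rewrite h in ndvd.
set m := (T %/ T')%N; set r := (T %% T')%N.
have rT' : (r < T')%N by rewrite ltn_mod.
have ET : T = (m * T' + r)%N by apply: divn_eq.
have m15 : (15 <= m)%N by rewrite leq_divRL.
(* The [m] windows inside the horizon leave at least [delta * m * T'] steps unjammed, the [m.+1]
   windows covering it at most [delta * m.+1 * T']. *)
have lo := exact_adversary_windows m 0 ex.
have hi := exact_adversary_windows m.+1 0 ex.
have split_hi : jam_count jam 0 (m.+1 * T') =
    (jam_count jam 0 T + jam_count jam T (T' - r))%N.
  rewrite (_ : (m.+1 * T')%N = (T + (T' - r))%N) ?jam_countD //.
  by rewrite ET -addnA subnKC ?(ltnW rT') // mulSnr.
have split_lo : jam_count jam 0 T =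
    (jam_count jam 0 (m * T') + jam_count jam (m * T') r)%N.
  by rewrite {1}ET jam_countD.
have b1 : (jam_count jam (m * T') r)%:R <= r%:R :> R by rewrite ler_nat jam_count_le.
have b2 : (jam_count jam T (T' - r))%:R <= T'%:R - r%:R :> R.
  by rewrite -natrB ?(ltnW rT') // ler_nat jam_count_le.
move: hi; rewrite split_hi natrD mulSn natrD => hi.
have EJ : (jam_count jam 0 T)%:R = (1 - delta) * (m * T')%:R + (jam_count jam (m * T') r)%:R :> R.
  by rewrite split_lo natrD lo.
have ETR : T%:R = (m * T')%:R + r%:R :> R by rewrite {1}ET natrD.
have rR : r%:R <= T'%:R :> R by rewrite ler_nat ltnW.
have mR : 15 * T'%:R <= (m * T')%:R :> R by rewrite -natrM ler_nat leq_mul2r m15 orbT.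
have D1 : delta * r%:R <= delta * T'%:R by rewrite ler_pM2l.
have D2 : delta * (15 * T'%:R) <= delta * (m * T')%:R by rewrite ler_pM2l.
have D3 : 0 <= delta * r%:R by rewrite mulr_ge0 // ltW.
have D4 : delta * T%:R = delta * (m * T')%:R + delta * r%:R by rewrite ETR mulrDr.
by lra.
Qed.

Lemma jamsE (R : realFieldType) (V : finType) (J : nat -> {set V}) T v :
  jams R J T v = (jam_count (fun t => v \in J t) 0 T)%:R.
Proof. by rewrite /jam_count add0n natr_sum. Qed.

Theorem theorem3 (R : realFieldType) :
  exists K : nat, forall C kappa : R, 0 < kappa -> exists A : R,
  forall (V : finType) (G : conflict_graph R V) (delta : R) (T' T : nat)
         (act : nat -> {set V}) (eps : R),
    C_independent G kappa C ->
    0 < delta -> delta <= 1 ->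
    (0 < T')%N -> (0 < T)%N ->
    eps <= 1 / (4 * #|V|%:R) * (delta ^+ 2 / (2 - delta)) ->
    (forall J : nat -> {set V},
       (T' <= T)%N ->
       individual (bounded_adversary T' (1 - delta)) J ->
       (forall v : V, average_regret G delta J act T v <= eps) ->
       approximates G (A / delta ^+ 2) J act T)
    /\
    (forall jam : nat -> bool,
       (T' %| T)%N \/ (K * T' <= T)%N ->
       exact_adversary T' (1 - delta) jam ->
       (forall v : V,
          average_regret G delta (jam_all V jam) act T v <= eps) ->
       approximates G (A / delta) (jam_all V jam) act T).
Proof.
(* 64 is the 32 of [feasible_le_successes] times the 2 in the upper bound of
   [exact_adversary_bounds]. *)
exists 15%N => C kappa k0; exists (64 * (1 + `|C|) / kappa).
move=> V G delta T' T act eps indep d0 d1 T'0 T0 eps_le.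
set B := (1 + `|C|) / kappa.
have B0 : 0 <= B by rewrite divr_ge0 ?addr_ge0 // ltW.
have T0R : 0 < T%:R :> R by rewrite ltr0n.
have [L /andP[fL _] EL] := opt_witness G set0.
split=> [J T'T indiv reg|jam hT ex reg].
  rewrite /approximates /average_optimum /average_successes mulrA ler_pM2r ?invr_gt0 //.
  rewrite total_successesE mulrAC ler_pdivlMr ?exprn_gt0 //.
  set S := \sum_v _; have S0 : 0 <= S by apply: sumr_ge0 => v _; apply: successes_ge0.
  have main : delta ^+ 2 * (#|L|%:R * T%:R) <= 32 * (1 + `|C|) / kappa * S.
    apply: (feasible_le_successes d0 d1 T0 k0 indep fL eps_le reg) => v.
    rewrite jamsE; apply: le_trans (indiv v 0 T T'T) _.
    by rewrite ler_pM2r //; lra.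
  have opt_le : (\sum_(0 <= t < T) opt G (J t))%:R <= #|L|%:R * T%:R :> R.
    rewrite -natrM ler_nat -EL mulnC -[X in (X * _)%N](subn0 T) -sum_nat_const_nat.
    by apply: leq_sum => t _; apply: opt_le_opt0.
  have := mulr_ge0 B0 S0.
  have : delta ^+ 2 * (\sum_(0 <= t < T) opt G (J t))%:R <= delta ^+ 2 * (#|L|%:R * T%:R).
    by rewrite ler_pM2l ?exprn_gt0.
  move: main; rewrite -[32 * _ / _]mulrA -[64 * _ / _]mulrA -/B; lra.
have /andP[lo hi] := exact_adversary_bounds d0 T0 T'0 hT ex.
rewrite /approximates /average_optimum /average_successes mulrA ler_pM2r ?invr_gt0 //.
rewrite total_successesE mulrAC ler_pdivlMr //.
set S := \sum_v _.
have main : delta ^+ 2 * (#|L|%:R * T%:R) <= 32 * (1 + `|C|) / kappa * S.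
  apply: (feasible_le_successes d0 d1 T0 k0 indep fL eps_le reg) => v.
  rewrite jamsE (_ : jam_count _ 0 T = jam_count jam 0 T); first lra.
  by apply: eq_bigr => t _; rewrite /jam_all; case: (jam t); rewrite inE.
(* A jammed step blocks every link and has optimum 0, so only unjammed steps contribute. *)
have opt_le : (\sum_(0 <= t < T) opt G (jam_all V jam t))%:R <=
    #|L|%:R * (T%:R - (jam_count jam 0 T)%:R) :> R.
  rewrite /jam_count add0n !natr_sum -[X in X - _]mul1r -sum_const_steps -sumrB mulr_sumr.
  apply: ler_sum => t _; rewrite /jam_all; case: (jam t) => /=.
    by rewrite opt_setT subrr mulr0.
  by rewrite subr0 mulr1 EL.
have : #|L|%:R * (T%:R - (jam_count jam 0 T)%:R) <= #|L|%:R * (2 * (delta * T%:R)).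
  by rewrite ler_wpM2l.
(* The unjammed steps supply one factor [delta]; multiplying by another gives the [delta ^+ 2] of
   [main]. *)
move/(le_trans opt_le); rewrite -(ler_pM2r d0).
move: main; rewrite -[32 * _ / _]mulrA -[64 * _ / _]mulrA -/B; lra.
Qed.
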